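(* Let $\Omega := \{0,1\}^{\infty}$ be the set of all infinite sequences $\omega=(\omega_1,\omega_2,\dots)$ of zeros and ones, let $\mathbb{N}:=\{1,2,\dots\}$, and for $n\in\mathbb{N}$ let $X_n(\omega):=\omega_n$. There exists a finitely additive probability measure $P$ defined on all subsets of $\Omega$ such that $P(X_n=1)=0$ for each $n\in\mathbb{N}$, whereas $P(\exists n\in\mathbb{N}: X_n=1)=1$.
   Context: A finitely additive probability measure on all subsets of $\Omega$ is a function $P:2^{\Omega}\to[0,1]$ with $P(\Omega)=1$ and $P(A\cup B)=P(A)+P(B)$ for all disjoint $A,B\subseteq\Omega$ (countable additivity is not required). Here $P(X_n=1)$ means $P(\{\omega\in\Omega: X_n(\omega)=1\})$, and $P(\exists n\in\mathbb{N}: X_n=1)$ means $P(\{\omega\in\Omega: X_n(\omega)=1\text{ for some }n\in\mathbb{N}\})$. The usual axiom of choice is assumed. *)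

(* Defs.v *)
From mathcomp Require Import all_boot all_order all_algebra.
From mathcomp Require Import boolp classical_sets reals.

Set Implicit Arguments.
Unset Strict Implicit.
Unset Printing Implicit Defensive.

Local Open Scope classical_set_scope.
Local Open Scope ring_scope.

(* [set T] is the full power set of T, so P is defined on all subsets. *)
Record finitely_additive_probability (R : realType) (T : Type)
    (P : set T -> R) : Prop := FinitelyAdditiveProbability {
  fap_unit_interval : forall A : set T, 0 <= P A <= 1;
  fap_setT : P [set: T] = 1;
  fap_additive : forall A B : set T,
    A `&` B = set0 -> P (A `|` B) = P A + P B }.

(* A sequence (omega_1, omega_2, ...) is stored with a 0-based index:
   its n-th term, for n >= 1, is [omega n.-1]. *)
Definition binary_sequence : Type := nat -> bool.

(* Only meant for n >= 1 (the junk value at n = 0 coincides with X 1).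
   The result is the bit read as the number 0 or 1. *)
Definition X (n : nat) (omega : binary_sequence) : nat := omega n.-1.

(* Main.v *)
(* Let e_k be the sequence whose only nonzero term is the one of index k, and
   let P A be 1 or 0 according to whether { k | e_k \in A } belongs to a fixed
   nonprincipal ultrafilter on the natural numbers.  The event X_n = 1 contains
   only one e_k, whereas every e_k has a nonzero term. *)

Require Import Defs.
From mathcomp Require Import all_boot all_order all_algebra.
From mathcomp Require Import boolp classical_sets reals.
From mathcomp Require Import filter.

Import Order.TTheory GRing.Theory Num.Theory.

Local Open Scope classical_set_scope.
Local Open Scope ring_scope.

(** This is the pushforward along [f] of the 0-1 measure of [G]: preimages of disjoint sets cannot
    both lie in [G], since members of [G] meet. *)
Lemma ultrafilter_finitely_additive (R : realType) (I T : Type)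
    (f : I -> T) (G : set_system I) : UltraFilter G ->
  finitely_additive_probability
    (fun A : set T => (`[< G (f @^-1` A) >] : bool)%:R : R).
Proof.
move=> GU; split.
- by move=> A; case: asbool; rewrite /= ?lexx ?ler01.
- by rewrite preimage_setT asboolT //; exact: filterT.
move=> A B AB0; rewrite preimage_setU.
have AB : ~ (G (f @^-1` A) /\ G (f @^-1` B)).
  case=> GA GB; have [i ABi] := filter_ex (filterI GA GB).
  by have: (A `&` B) (f i) by []; rewrite AB0.
case: asboolP => [GAB|nGAB]; last first.
  rewrite !asboolF ?addr0 // => GC; apply: nGAB; apply: filterS GC.
  - exact: subsetUr.
  - exact: subsetUl.
(* Maximality of [G] makes one of the two summands equal to 1. *)
have [GA|GnA] := in_ultra_setVsetC (f @^-1` A) GU.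
  by rewrite asboolT // asboolF ?addr0 // => GB; apply: AB.
have GB : G (f @^-1` B).
  by apply: filterS (filterI GAB GnA) => i [[]].
by rewrite (asboolT GB) asboolF ?add0r // => GA; apply: AB.
Qed.

Theorem proposition3 (R : realType) :
  exists P : set binary_sequence -> R,
    [/\ finitely_additive_probability P,
        forall n : nat, (1 <= n)%N ->
          P [set omega | X n omega = 1%N] = 0
      & P [set omega | exists n : nat, (1 <= n)%N /\ X n omega = 1%N] = 1].
Proof.
(* Containing all tails of [nat] makes [G] nonprincipal. *)
have [G [GU ooG]] := ultraFilterLemma eventually_filter.
pose e (k : nat) : binary_sequence := fun j => j == k.
exists (fun A => (`[< G (e @^-1` A) >] : bool)%:R); split.
- exact: ultrafilter_finitely_additive.
- move=> n _; rewrite asboolF // => GX.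
  (* This tail excludes [n.-1], the only [k] with [X n (e k) = 1]. *)
  have Gn : G [set k | (n.-1 < k)%N] by apply: ooG; exists n.-1.+1.
  have [k /= []] := filter_ex (filterI GX Gn).
  by rewrite /X /e; case: eqP => // ->; rewrite ltnn.
- rewrite asboolT //; apply: filterS filterT => k _.
  by exists k.+1; split=> //; rewrite /X /e eqxx.
Qed.
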